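(* Let $\overline w_i=\mathcal K\big(\frac{\boldsymbol\gamma-\boldsymbol\gamma^i}{h}\big)/\sum_{j=1}^n\mathcal K\big(\frac{\boldsymbol\gamma-\boldsymbol\gamma^j}{h}\big)$, $i\in[n]$, denote the empirical weights obtained from Nadaraya-Watson regression, and let $\hat{\mathbb P}_{\boldsymbol\gamma}=\sum_{i=1}^n\overline w_i\delta_{\boldsymbol\xi^i}$ be the empirical conditional distribution. For any $\boldsymbol x\in\mathcal X$, $$\hat{\mathbb E}_{\boldsymbol\gamma}[\ell(\boldsymbol x,\tilde{\boldsymbol\xi})]+\left(\lambda\sqrt{\hat{\mathbb V}_{\boldsymbol\gamma}[\ell(\boldsymbol x,\tilde{\boldsymbol\xi})]}-\lambda^2\right)_+\le\max_{\mathbb P\in\mathcal P_\lambda(\hat{\mathbb P}_{\boldsymbol\gamma})}\mathbb E_{\mathbb P}[\ell(\boldsymbol x,\tilde{\boldsymbol\xi})]\le\hat{\mathbb E}_{\boldsymbol\gamma}[\ell(\boldsymbol x,\tilde{\boldsymbol\xi})]+\lambda\sqrt{\hat{\mathbb V}_{\boldsymbol\gamma}[\ell(\boldsymbol x,\tilde{\boldsymbol\xi})]},$$ where $$\mathcal P_\lambda(\hat{\mathbb P}_{\boldsymbol\gamma})=\left\{\mathbb P=\sum_{i=1}^nw_i\delta_{\boldsymbol\xi^i}\ :\ \sum_{i=1}^n\frac{(w_i-\overline w_i)^2}{2\overline w_i}\le\frac{\lambda^2}{2},\ \boldsymbol w\in\Delta^n\right\}$$ is a modified $\chi^2$ ambiguity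 set constructed around the empirical conditional distribution. In particular, if $\hat{\mathbb V}_{\boldsymbol\gamma}[\ell(\boldsymbol x,\tilde{\boldsymbol\xi})]\ge\lambda^2$, then $$\max_{\mathbb P\in\mathcal P_\lambda(\hat{\mathbb P}_{\boldsymbol\gamma})}\mathbb E_{\mathbb P}[\ell(\boldsymbol x,\tilde{\boldsymbol\xi})]=\hat{\mathbb E}_{\boldsymbol\gamma}[\ell(\boldsymbol x,\tilde{\boldsymbol\xi})]+\lambda\sqrt{\hat{\mathbb V}_{\boldsymbol\gamma}[\ell(\boldsymbol x,\tilde{\boldsymbol\xi})]}.$$
   Context: Data $(\boldsymbol\gamma^i,\boldsymbol\xi^i)\in\mathbb R^p\times\mathbb R^q$, $i\in[n]=\{1,\dots,n\}$, with $\boldsymbol\xi^i\in\Xi$ ($\Xi$ the compact support of $\tilde{\boldsymbol\xi}$), a fixed $\boldsymbol\gamma\in\mathbb R^p$, a bandwidth $h>0$ and a regularization parameter $\lambda\ge0$ are given; $\mathcal X\subseteq\mathbb R^d$ is the feasible set. Standing assumptions: $\ell(\boldsymbol x,\boldsymbol\xi)\in[0,1]$ for all $\boldsymbol x\in\mathcal X,\boldsymbol\xi\in\Xi$, and $\ell(\cdot,\boldsymbol\xi)$ is convex for all $\boldsymbol\xi\in\Xi$. The kernel is $\mathcal K(\boldsymbol\theta)=\frac1Z\exp(-\|\boldsymbol\theta\|_2)$ with $Z=\int_{\mathbb R^p}\exp(-\|\boldsymbol\theta\|_2)\,d\boldsymbol\theta$. The Nadaraya-Watson estimator is $\hat{\mathbb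 E}_{\boldsymbol\gamma}[\ell(\boldsymbol x,\tilde{\boldsymbol\xi})]=\sum_{i=1}^n\overline w_i\,\ell(\boldsymbol x,\boldsymbol\xi^i)$ and the empirical conditional variance is $\hat{\mathbb V}_{\boldsymbol\gamma}[\ell(\boldsymbol x,\tilde{\boldsymbol\xi})]=\sum_{i=1}^n\overline w_i\big(\ell(\boldsymbol x,\boldsymbol\xi^i)-\hat{\mathbb E}_{\boldsymbol\gamma}[\ell(\boldsymbol x,\tilde{\boldsymbol\xi})]\big)^2$. $\delta_{\boldsymbol\xi}$ is the Dirac distribution at $\boldsymbol\xi$, $\Delta^n=\{\boldsymbol w\in\mathbb R^n_+:\sum_iw_i=1\}$, and $(a)_+=\max(a,0)$. For $\mathbb P=\sum_iw_i\delta_{\boldsymbol\xi^i}$, $\mathbb E_{\mathbb P}[\ell(\boldsymbol x,\tilde{\boldsymbol\xi})]=\sum_iw_i\ell(\boldsymbol x,\boldsymbol\xi^i)$. *)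

(* Defs.v *)
From HB Require Import structures.
From mathcomp Require Import all_boot all_order all_algebra.
From mathcomp Require Import all_classical all_reals all_analysis.
From mathcomp Require Import measurable_realfun lra.

Set Implicit Arguments.
Unset Strict Implicit.
Unset Printing Implicit Defensive.

Import Order.TTheory GRing.Theory Num.Theory.
Import numFieldNormedType.Exports.

Local Open Scope classical_set_scope.
Local Open Scope ring_scope.

(* The sigma-algebra on R^n is generated by the coordinates; as the topology
   of R is second countable, it is the Borel sigma-algebra. *)
Section measurable_rV.
Context {R : realType} {n : nat}.

Definition rV_coord (i : 'I_n) (v : 'rV[R]_n) : R := v 0 i.

Let rV_set0 : g_sigma_preimage rV_coord set0.
Proof. exact: sigma_algebra0. Qed.

Let rV_setC A : g_sigma_preimage rV_coord A -> g_sigma_preimage rV_coord (~` A).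
Proof. exact: sigma_algebraC. Qed.

Let rV_bigcup (F : (set 'rV[R]_n)^nat) :
  (forall i, g_sigma_preimage rV_coord (F i)) ->
  g_sigma_preimage rV_coord (\bigcup_i F i).
Proof. exact: sigma_algebra_bigcup. Qed.

HB.instance Definition _ := @isMeasurable.Build default_measure_display
  'rV[R]_n (g_sigma_preimage rV_coord) rV_set0 rV_setC rV_bigcup.

Lemma measurable_rV_coord (i : 'I_n) :
  measurable_fun [set: 'rV[R]_n] (rV_coord i).
Proof.
move=> _ Y mY; rewrite setTI; apply: sub_sigma_algebra => /=.
rewrite -bigcup_seq/=; exists i => /=; first by rewrite mem_index_enum.
by exists Y => //; rewrite setTI.
Qed.

Lemma measurable_fun_rV d (T : measurableType d) (f : T -> 'rV[R]_n) :
  (forall i, measurable_fun [set: T] (fun t => f t 0 i)) ->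
  measurable_fun [set: T] f.
Proof.
move=> mf _ A mA.
suff: g_sigma_preimage (fun i => rV_coord i \o f) `<=` measurable.
  by apply; rewrite g_sigma_preimage_comp; exists A.
apply: smallest_sub; first exact: sigma_algebra_measurable.
move=> B; rewrite -bigcup_seq => -[i _] [C mC <-].
exact: mf.
Qed.

End measurable_rV.

Section lebesgue_rV.
Context {R : realType}.
Local Notation mR := (measurableTypeR R).

Definition rV_cons n (xv : mR * 'rV[R]_n) : 'rV[R]_n.+1 :=
  \row_(i < n.+1) if unlift ord0 i is Some j then xv.2 0 j else xv.1.

Definition rV_uncons n (v : 'rV[R]_n.+1) : mR * 'rV[R]_n :=
  (v 0 ord0, \row_(j < n) v 0 (lift ord0 j)).

Lemma rV_consK n : cancel (@rV_cons n) (@rV_uncons n).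
Proof.
case=> x v; rewrite /rV_uncons /rV_cons mxE unlift_none; congr (_, _).
by apply/rowP => j; rewrite !mxE liftK.
Qed.

Lemma measurable_rV_cons n :
  measurable_fun [set: (mR * 'rV[R]_n)%type] (@rV_cons n).
Proof.
apply: measurable_fun_rV => i; under eq_fun do rewrite mxE.
case: unliftP => [j _|_]; last exact: measurable_fst.
exact: measurableT_comp (measurable_rV_coord j) measurable_snd.
Qed.

Lemma measurable_rV_uncons n :
  measurable_fun [set: 'rV[R]_n.+1] (@rV_uncons n).
Proof.
apply: measurable_fun_pair => /=; first exact: measurable_rV_coord.
apply: measurable_fun_rV => j; under eq_fun do rewrite mxE.
exact: measurable_rV_coord.
Qed.

Section step.
Context {n : nat} (m : {sigma_finite_measure set 'rV[R]_n -> \bar R}).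

Definition lebesgue_rV_step : set 'rV[R]_n.+1 -> \bar R :=
  pushforward (lebesgue_measure \x m)%E (@rV_cons n).

Let mpre (A : set 'rV[R]_n.+1) : measurable A -> measurable (@rV_cons n @^-1` A).
Proof. by move=> mA; rewrite -[X in measurable X]setTI; exact: measurable_rV_cons. Qed.

Let step0 : lebesgue_rV_step set0 = 0%E.
Proof. by rewrite /lebesgue_rV_step /pushforward preimage_set0 measure0. Qed.

Let step_ge0 A : (0 <= lebesgue_rV_step A)%E.
Proof. by rewrite /lebesgue_rV_step /pushforward; exact: measure_ge0. Qed.

Let step_sigma_additive : semi_sigma_additive lebesgue_rV_step.
Proof.
move=> F mF tF mUF; rewrite /lebesgue_rV_step /pushforward preimage_bigcup.
apply: measure_semi_sigma_additive => [i| |]; first exact: mpre.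
- apply/trivIsetP => /= i j _ _ ij; rewrite -preimage_setI.
  by move/trivIsetP : tF => /(_ _ _ _ _ ij) ->//; rewrite preimage_set0.
- by rewrite -preimage_bigcup; exact: mpre.
Qed.

HB.instance Definition _ := isMeasure.Build _ _ _
  lebesgue_rV_step step0 step_ge0 step_sigma_additive.

Let step_sigma_finite : sigma_finite setT lebesgue_rV_step.
Proof.
have /sigma_finiteP[F [TF ndF Foo]] := sigma_finiteT (@lebesgue_measure R).
have /sigma_finiteP[G [TG ndG Goo]] := sigma_finiteT m.
exists (fun k => @rV_uncons n @^-1` (F k `*` G k)).
  rewrite -preimage_bigcup (_ : \bigcup_k (F k `*` G k) = setT) ?preimage_setT//.
  rewrite -subTset => -[x y] _.
  have [k1 _ Fx] : (\bigcup_k F k) x by rewrite -TF.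
  have [k2 _ Gy] : (\bigcup_k G k) y by rewrite -TG.
  exists (maxn k1 k2) => //; split=> /=.
    by move: x Fx; exact/subsetPset/ndF/leq_maxl.
  by move: y Gy; exact/subsetPset/ndG/leq_maxr.
move=> k; have [mFk Fk] := Foo k; have [mGk Gk] := Goo k; split.
  rewrite -[X in measurable X]setTI; apply: measurable_rV_uncons => //.
  exact: measurableX.
rewrite /lebesgue_rV_step /pushforward -comp_preimage.
rewrite (_ : @rV_uncons n \o @rV_cons n = id); last first.
  by apply/funext => xv; exact: rV_consK.
by rewrite preimage_id product_measure1E// lte_mul_pinfty// ge0_fin_numE.
Qed.

HB.instance Definition _ := @Measure_isSigmaFinite.Build _ _ _
  lebesgue_rV_step step_sigma_finite.

End step.

(* Lebesgue measure on R^n; R^0 is a point of mass 1. *)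
Fixpoint lebesgue_rV n : {sigma_finite_measure set 'rV[R]_n -> \bar R} :=
  if n is n'.+1 then lebesgue_rV_step (lebesgue_rV n') else \d_(0 : 'rV[R]_0).

Lemma lebesgue_rV_box n (A : 'I_n -> set R) :
  (forall i, measurable (A i)) ->
  lebesgue_rV n [set v | forall i, A i (v 0 i)]
    = (\prod_(i < n) lebesgue_measure (A i))%E.
Proof.
elim: n A => [|n IHn] A mA.
  by rewrite big_ord0 /= diracE mem_set//; case.
rewrite big_ord_recl /= /lebesgue_rV_step /pushforward -IHn//.
rewrite -product_measure1E//.
- congr (_ _); apply/seteqP; split=> [[x v] H|[x v] [/= Hx Hv] i].
  + split=> [|i] /=; first by have := H ord0; rewrite /rV_cons mxE unlift_none.
    by have := H (lift ord0 i); rewrite /rV_cons mxE liftK.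
  + by rewrite /rV_cons mxE; case: unliftP => [j ->|->].
- exact: (mA ord0).
- rewrite (_ : (fun _ => _) =
      \bigcap_(i in [set` index_enum 'I_n]) (rV_coord i @^-1` A (lift ord0 i))).
    rewrite bigcap_seq; apply: bigsetI_measurable => i _.
    by rewrite -[X in measurable X]setTI; exact: measurable_rV_coord.
  apply/seteqP; split => v /= H i; first by move=> _; exact: H.
  by apply: H; rewrite /= mem_index_enum.
Qed.

End lebesgue_rV.

Section nadaraya_watson.
Context {R : realType}.

(* The library norm on 'rV is the sup norm; this is the Euclidean one. *)
Definition norm2 p (v : 'rV[R]_p) : R := Num.sqrt (\sum_(i < p) v 0 i ^+ 2).

Definition kernel_Z p : R :=
  \int[lebesgue_rV p]_(theta in [set: 'rV[R]_p]) expR (- norm2 theta).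

Definition expkernel p (theta : 'rV[R]_p) : R :=
  (kernel_Z p)^-1 * expR (- norm2 theta).

Definition nw_weight n p (h : R) (gamma : 'rV[R]_p) (gam : 'I_n -> 'rV[R]_p)
    (i : 'I_n) : R :=
  expkernel (h^-1 *: (gamma - gam i)) /
  \sum_(j < n) expkernel (h^-1 *: (gamma - gam j)).

Definition nw_mean n (wbar y : 'I_n -> R) : R := \sum_(i < n) wbar i * y i.

Definition nw_var n (wbar y : 'I_n -> R) : R :=
  \sum_(i < n) wbar i * (y i - nw_mean wbar y) ^+ 2.

End nadaraya_watson.

Section ambiguity.
Context {R : realType}.

Definition simplex n : set ('I_n -> R) :=
  [set w | (forall i, 0 <= w i) /\ \sum_(i < n) w i = 1].

(* P = \sum_i w_i \d_(xi_i), as measures. *)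
Definition is_discrete n q (w : 'I_n -> R) (xi : 'I_n -> 'rV[R]_q)
    (P : probability 'rV[R]_q R) :=
  forall A, measurable A -> P A = (\sum_(i < n) (w i)%:E * \d_(xi i) A)%E.

(* The atoms xi_i may coincide, so the set is indexed by the reference weights
   wbar rather than by the measure \sum_i wbar_i \d_(xi_i) alone. *)
Definition chi2_ambiguity n q (lambda : R) (wbar : 'I_n -> R)
    (xi : 'I_n -> 'rV[R]_q) : set (probability 'rV[R]_q R) :=
  [set P | exists w : 'I_n -> R,
    [/\ is_discrete w xi P,
        \sum_(i < n) (w i - wbar i) ^+ 2 / (2 * wbar i) <= lambda ^+ 2 / 2
      & simplex w] ].

End ambiguity.

Definition is_max d (T : porderType d) (A : set T) (M : T) :=
  A M /\ ubound A M.

Section expectation_discrete.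
Context {R : realType}.
Local Open Scope ereal_scope.

Import HBNNSimple.

Lemma measurable_rV_set1 q (z : 'rV[R]_q) : measurable [set z].
Proof.
rewrite (_ : [set z] =
    \bigcap_(i in [set` index_enum 'I_q]) (rV_coord i @^-1` [set z 0%R i])).
  rewrite bigcap_seq; apply: bigsetI_measurable => i _.
  rewrite -[X in measurable X]setTI.
  by apply: measurable_rV_coord => //; exact: measurable_set1.
apply/seteqP; split => [v -> i //|v /= H].
by apply/rowP => i; apply: H; rewrite /= mem_index_enum.
Qed.

Let ge0_integral_discrete n q (w : 'I_n -> R) (xi : 'I_n -> 'rV[R]_q)
    (P : probability 'rV[R]_q R) (f : 'rV[R]_q -> \bar R) :
  (forall i, 0 <= w i)%R -> is_discrete w xi P ->
  measurable_fun [set: 'rV[R]_q] f -> (forall z, 0 <= f z) ->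
  \int[P]_z f z = \sum_(i < n) (w i)%:E * f (xi i).
Proof.
move=> w0 Pw mf f0.
pose m_ (k : nat) : {measure set 'rV[R]_q -> \bar R} :=
  if insub k is Some i then mscale (NngNum (w0 i)) (\d_(xi i)) else mzero.
have m_E (i : 'I_n) : m_ i = mscale (NngNum (w0 i)) (\d_(xi i)).
  by rewrite /m_ valK.
transitivity (\int[msum m_ n]_z f z).
  apply: eq_measure_integral => A mA _.
  by apply: (etrans (Pw _ mA)); apply: eq_bigr => i _; rewrite m_E.
rewrite ge0_integral_measure_sum//; apply: eq_bigr => i _.
by rewrite m_E ge0_integral_mscale// integral_dirac// diracE in_setT mul1e.
Qed.

Let nng_expectation_discrete n q (w : 'I_n -> R) (xi : 'I_n -> 'rV[R]_q)
    (P : probability 'rV[R]_q R) (f : 'rV[R]_q -> \bar R) :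
  (forall i, 0 <= w i)%R -> is_discrete w xi P -> (forall z, 0 <= f z) ->
  \int[P]_z f z = \sum_(i < n) (w i)%:E * f (xi i).
Proof.
move=> w0 Pw f0; apply/eqP; rewrite eq_le; apply/andP; split.
  rewrite ge0_integralTE//; apply: ge_ereal_sup => _ [g gf <-].
  rewrite -integralT_nnsfun (ge0_integral_discrete w0 Pw)//.
  - by apply: lee_sum => i _; rewrite lee_wpmul2l ?lee_fin//; exact: gf.
  - exact/measurable_EFinP/measurable_funP.
  - by move=> z; rewrite lee_fin.
pose S := range xi.
have fS : finite_set S by exact: finite_image.
have mS (B : set 'rV[R]_q) : B `<=` S -> measurable B.
  move=> BS; rewrite -[X in measurable X](image_id B) -bigcup_imset1.
  apply: fin_bigcup_measurable; first exact: sub_finite_set fS.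
  by move=> z _; exact: measurable_rV_set1.
have mfS : measurable_fun [set: 'rV[R]_q] (f \_ S).
  apply/(measurable_restrictT _ (mS _ (@subset_refl _ _))) => _ B _.
  by apply: mS; exact: subIsetl.
have fS0 z : 0 <= (f \_ S) z by rewrite patchE; case: ifPn.
apply: (@le_trans _ _ (\int[P]_z (f \_ S) z)).
  rewrite (ge0_integral_discrete w0 Pw)//; apply: lee_sum => i _.
  by rewrite patchE mem_set//; exists i.
rewrite !ge0_integralTE//; apply: ereal_sup_le => _ [g gf <-]; exists g => //= z.
by rewrite (le_trans (gf z))// patchE; case: ifPn.
Qed.

(* No measurability of f is needed: singletons are measurable, so the library
   integral against a finitely supported measure only sees the atoms. *)
Lemma expectation_discrete n q (w : 'I_n -> R) (xi : 'I_n -> 'rV[R]_q)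
    (P : probability 'rV[R]_q R) (f : 'rV[R]_q -> R) :
  simplex w -> is_discrete w xi P ->
  'E_P[f] = (\sum_(i < n) w i * f (xi i))%R%:E.
Proof.
move=> [w0 _] Pw; rewrite unlock integralE.
rewrite (nng_expectation_discrete w0 Pw)// (nng_expectation_discrete w0 Pw)//.
transitivity ((\sum_(i < n) w i * Num.max (f (xi i)) 0)%R%:E -
              (\sum_(i < n) w i * Num.max (- f (xi i)) 0)%R%:E).
  rewrite -!sumEFin; congr (_ - _); apply: eq_bigr => i _.
    by rewrite EFinM EFin_max funeposE.
  by rewrite EFinM EFin_max funenegE.
rewrite -EFinB -sumrB; congr EFin; apply: eq_bigr => i _.
rewrite -mulrBr; congr (_ * _)%R.
by case: (leP (f (xi i)) 0%R) => fi; case: leP => fi'; lra.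
Qed.

End expectation_discrete.

(* Main.v *)
Require Import Defs.
From mathcomp Require Import all_boot all_order all_algebra.
From mathcomp Require Import all_classical all_reals all_analysis.
From mathcomp Require Import measurable_realfun ring lra.

(* Write E and V for the weighted mean and variance of y_i = l(x, xi_i) under
   wbar.  For weights w with the same total mass, the gap between the two means
   is sum_i (w_i - wbar_i) (y_i - E), which Cauchy-Schwarz bounds by
   lambda sqrt V on the chi-square ball.  Equality calls for the tilted weights
   wbar_i (1 + t (y_i - E)), whose mean is E + t V and whose chi-square distance
   is t^2 V / 2.  As y takes values in [0, 1], they are nonnegative for
   0 <= t <= 1: t = lambda / sqrt V is admissible as soon as lambda^2 <= V, and
   t = 1 gives the lower bound otherwise.
   All of this needs wbar_i > 0, hence a normalizing constant Z that is positive
   and finite (an infinite integral would be read as 0). *)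

Import Order.TTheory GRing.Theory Num.Theory.
Import numFieldNormedType.Exports.

Local Open Scope classical_set_scope.
Local Open Scope ring_scope.

(** * Means and chi-square distances of weight vectors *)

Section chi2_ball.
Context {R : realType} {n : nat}.
Implicit Types (wbar w y : 'I_n -> R).

(** With equal totals, a constant shift of [y] cancels in the gap, so [c] is free; centring at the
    mean brings in the variance. *)
Lemma sum_mean_gap wbar w y (c : R) :
  \sum_(i < n) w i = \sum_(i < n) wbar i ->
  nw_mean w y - nw_mean wbar y = \sum_(i < n) (w i - wbar i) * (y i - c).
Proof.
move=> ww; rewrite /nw_mean -sumrB.
transitivity (\sum_(i < n) ((w i - wbar i) * (y i - c) + (w i - wbar i) * c)).
  by apply: eq_bigr => i _; ring.
by rewrite big_split/= -mulr_suml sumrB ww subrr mul0r addr0.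
Qed.

Lemma nw_var_ge0 wbar y : (forall i, 0 <= wbar i) -> 0 <= nw_var wbar y.
Proof. by move=> w0; apply: sumr_ge0 => i _; rewrite mulr_ge0// sqr_ge0. Qed.

(** The quadratic [\sum_i r i * (a i / r i - t * b i) ^+ 2] in [t] is nonnegative, so its
    discriminant is at most 0. *)
Lemma sum_CauchySchwarz (r a b : 'I_n -> R) : (forall i, 0 < r i) ->
  (\sum_(i < n) a i * b i) ^+ 2 <=
  (\sum_(i < n) a i ^+ 2 / r i) * (\sum_(i < n) r i * b i ^+ 2).
Proof.
move=> r0; set A := \sum_i _ ^+ 2 / _; set V := \sum_i _ * _ ^+ 2.
set D := \sum_i _.
pose P := \poly_(i < 3) [:: A; - (2 * D); V]`_i.
have P0 t : 0 <= P.[t].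
  rewrite horner_poly !big_ord_recl big_ord0/=.
  rewrite [leRHS](_ : _ = \sum_(i < n) r i * (a i / r i - t * b i) ^+ 2).
    by apply: sumr_ge0 => i _; rewrite mulr_ge0 ?sqr_ge0// ltW.
  rewrite expr0 expr1 mulr1 addr0 /bump/= /A /D /V.
  rewrite -mulrN -sumrN mulr_sumr !mulr_suml -!big_split/=.
  by apply: eq_bigr => i _; field; rewrite gt_eqF.
have := deg_le2_poly_ge0 (size_poly _ _) P0; rewrite !coef_poly/=.
by move=> H; lra.
Qed.

Lemma nw_mean_le wbar w y (lambda : R) : (forall i, 0 < wbar i) ->
  0 <= lambda -> \sum_(i < n) w i = \sum_(i < n) wbar i ->
  \sum_(i < n) (w i - wbar i) ^+ 2 / (2 * wbar i) <= lambda ^+ 2 / 2 ->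
  nw_mean w y <= nw_mean wbar y + lambda * Num.sqrt (nw_var wbar y).
Proof.
move=> w0 l0 ww; set A := \sum_i _ => Al.
have Vge0 : 0 <= nw_var wbar y by apply: nw_var_ge0 => i; exact: ltW.
rewrite -lerBlDl (sum_mean_gap _ _ _ (nw_mean wbar y) ww).
apply: (le_trans (ler_norm _)).
rewrite -ler_sqr ?nnegrE ?mulr_ge0 ?sqrtr_ge0//.
rewrite real_normK ?num_real// exprMn sqr_sqrtr//.
apply: le_trans (sum_CauchySchwarz wbar _ _ w0) _.
apply: ler_wpM2r => //.
(* The factor 2 comes from the denominators [2 * wbar i] of the chi-square distance. *)
rewrite (_ : \sum_i _ = 2 * A); first lra.
rewrite mulr_sumr; apply: eq_bigr => i _.
by field; rewrite gt_eqF.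
Qed.

(** The deviation from [wbar] is proportional to [wbar i * (y i - nw_mean wbar y)]: the equality
    case of [sum_CauchySchwarz] with [r := wbar]. *)
Definition tilted_weight wbar y (t : R) (i : 'I_n) : R :=
  wbar i * (1 + t * (y i - nw_mean wbar y)).

Lemma sum_tilted wbar y (t : R) : \sum_(i < n) wbar i = 1 ->
  \sum_(i < n) tilted_weight wbar y t i = 1.
Proof.
move=> w1; rewrite /tilted_weight.
under eq_bigr do rewrite mulrDr mulr1 mulrCA mulrBr.
by rewrite big_split/= -mulr_sumr sumrB -mulr_suml w1 mul1r subrr mulr0 addr0.
Qed.

(** As [y] is nonnegative and its mean is at most 1, [y i - nw_mean wbar y >= -1], so the tilting
    factor is at least [1 - t]. *)
Lemma tilted_simplex wbar y (t : R) : simplex wbar ->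
  (forall i, 0 <= y i <= 1) -> 0 <= t <= 1 -> simplex (tilted_weight wbar y t).
Proof.
move=> [w0 w1] y01 /andP[t0 t1].
have E1 : nw_mean wbar y <= 1.
  rewrite -w1; apply: ler_sum => i _.
  by rewrite ler_piMr//; case/andP: (y01 i).
split=> [i|]; last exact: sum_tilted.
  rewrite mulr_ge0//; have /andP[yi0 _] := y01 i.
  have : t * (nw_mean wbar y - y i) <= 1 by nra.
  lra.
Qed.

Lemma tilted_chi2 wbar y (t : R) : (forall i, 0 < wbar i) ->
  \sum_(i < n) (tilted_weight wbar y t i - wbar i) ^+ 2 / (2 * wbar i) =
  t ^+ 2 * nw_var wbar y / 2.
Proof.
move=> w0; rewrite mulrC /nw_var !mulr_sumr; apply: eq_bigr => i _.
by rewrite /tilted_weight; field; rewrite gt_eqF.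
Qed.

Lemma tilted_mean wbar y (t : R) : \sum_(i < n) wbar i = 1 ->
  nw_mean (tilted_weight wbar y t) y = nw_mean wbar y + t * nw_var wbar y.
Proof.
move=> w1; apply/eqP; rewrite -subr_eq0 opprD addrA subr_eq0; apply/eqP.
rewrite (sum_mean_gap _ _ _ (nw_mean wbar y)).
  rewrite /nw_var mulr_sumr; apply: eq_bigr => i _.
  by rewrite /tilted_weight; ring.
by rewrite sum_tilted.
Qed.

Lemma continuous_sum_coord (f : 'I_n -> R -> R) :
  (forall i, continuous (f i)) ->
  continuous (fun v : 'rV[R]_n => \sum_(i < n) f i (v 0 i)).
Proof.
move=> cf; apply: continuous_big => [|i _ v].
  exact: add_continuous.
by apply: continuous_comp; [exact: coord_continuous|exact: cf].
Qed.

(** The feasible weights form a nonempty closed part of the unit cube, and the mean is continuous in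
    the weights. Row vectors stand in for functions to supply the topology. *)
Lemma chi2_ball_argmax wbar y (lambda : R) : simplex wbar ->
  exists w, [/\ simplex w,
    \sum_(i < n) (w i - wbar i) ^+ 2 / (2 * wbar i) <= lambda ^+ 2 / 2 &
    forall w', simplex w' ->
      \sum_(i < n) (w' i - wbar i) ^+ 2 / (2 * wbar i) <= lambda ^+ 2 / 2 ->
      nw_mean w' y <= nw_mean w y].
Proof.
move=> sw.
pose chi2 (v : 'rV[R]_n) :=
  \sum_(i < n) (v 0 i - wbar i) ^+ 2 / (2 * wbar i).
pose A := [set v : 'rV[R]_n | simplex (v 0) /\ chi2 v <= lambda ^+ 2 / 2].
have cA : compact A.
  apply: (@subclosed_compact _ _
    [set v : 'rV[R]_n | forall i, `[0, 1]%classic (v 0 i)]).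
  - rewrite (_ : A =
      (\bigcap_(i in [set: 'I_n]) ((fun v : 'rV[R]_n => v 0 i) @^-1` [set a | 0 <= a])
      `&` (fun v : 'rV[R]_n => \sum_(i < n) v 0 i) @^-1` [set a | a = 1])
      `&` chi2 @^-1` [set a | a <= lambda ^+ 2 / 2]); last first.
      apply/seteqP; split=> v.
        by move=> [[v0 v1] vl]; split => //; split => // i _; exact: v0.
      by move=> [[v0 v1] vl]; split => //; split => // i; exact: v0.
    apply: closedI; [apply: closedI|].
    + apply: closed_bigI => i _; apply: preimage_closed; last exact: closed_ge.
      by move=> v _; exact: coord_continuous.
    + apply: preimage_closed; last exact: closed_eq.
      by move=> v _; apply: (continuous_sum_coord (fun=> id)) => i z; exact: cvg_id.
    + apply: preimage_closed; last exact: closed_le.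
      move=> v _; apply: (continuous_sum_coord
        (fun i z => (z - wbar i) ^+ 2 / (2 * wbar i))) => i z.
      apply: cvgMr_tmp; rewrite expr2.
      by apply: cvgM; apply: cvgB => //; exact: cvg_cst.
  - apply: (@rV_compact R n (fun=> `[0, 1]%classic)) => _.
    exact: segment_compact.
  (* A coordinate of nonnegative weights is at most their total, 1. *)
  - move=> v [[v0 v1] _] i /=; rewrite in_itv/= v0/= -v1.
    by rewrite (bigD1 i)//= lerDl sumr_ge0.
have [||v /set_mem[sv vl] vmax] :=
    @EVT_max_rV R n (fun v => nw_mean (v 0) y) A _ cA.
(* The centre [wbar] is feasible, at distance 0. *)
- exists (\row_i wbar i); split.
    by rewrite (_ : _ 0 = wbar)//; apply/funext => i; rewrite mxE.
  rewrite /chi2 big1 ?divr_ge0 ?sqr_ge0// => i _.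
  by rewrite mxE subrr expr0n mul0r.
- apply: continuous_subspaceT.
  apply: (continuous_sum_coord (fun i z => z * y i)) => i z.
  by apply: cvgMr_tmp.
- exists (v 0); split => // w' sw' w'l.
  have rE : (\row_i w' i) 0 = w' by apply/funext => i; rewrite mxE.
  rewrite -rE; apply: vmax; apply/mem_set; split; first by rewrite rE.
  by rewrite /chi2; under eq_bigr do rewrite mxE.
Qed.

End chi2_ball.

(** * Weighted sums of Dirac masses as probabilities *)

Section discrete_probability.
Context {R : realType}.
Local Open Scope ereal_scope.

Lemma discrete_probability n q (w : 'I_n -> R) (xi : 'I_n -> 'rV[R]_q) :
  simplex w -> exists P : probability 'rV[R]_q R, is_discrete w xi P.
Proof.
move=> [w0 w1].
(* [msum] takes a family indexed by [nat]; indices outside ['I_n] get the zero measure. *)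
pose m_ (k : nat) : {measure set 'rV[R]_q -> \bar R} :=
  if insub k is Some i then mscale (NngNum (w0 i)) (\d_(xi i)) else mzero.
have m_E (i : 'I_n) : m_ i = mscale (NngNum (w0 i)) (\d_(xi i)).
  by rewrite /m_ valK.
have mE A : msum m_ n A = \sum_(i < n) (w i)%:E * \d_(xi i) A.
  by rewrite /msum; apply: eq_bigr => i _; rewrite m_E.
have mT : msum m_ n setT = 1.
  rewrite mE; under eq_bigr do rewrite diracT mule1.
  by rewrite sumEFin w1.
(* The total mass is 1, so normalizing changes nothing but supplies the probability structure; the
   Dirac mass at 0 is the default for mass 0 or infinity. *)
exists (mnormalize (msum m_ n) \d_(0%R : 'rV[R]_q)) => A _.
rewrite /= /mnormalize ifF; last first.
  by apply/negP => /orP[] /eqP /(etrans (esym mT)) => // /eqP; rewrite onee_eq0.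
set e := (X in fine X); have -> : e = 1 by exact: mT.
by rewrite /= invr1 mule1 mE.
Qed.

End discrete_probability.

(** * Positivity and finiteness of the normalizing constant of the kernel *)

Section kernel_normalization.
Context {R : realType}.
Local Notation mu := (@lebesgue_measure R).

Lemma measurable_norm2 p : measurable_fun [set: 'rV[R]_p] (@norm2 R p).
Proof.
apply: (measurableT_comp (f := @Num.sqrt R)).
  by apply: continuous_measurable_fun; exact: sqrt_continuous.
apply: measurable_sum => i.
by apply: (measurable_funX 2); exact: (measurable_rV_coord i).
Qed.

Lemma normr_le_norm2 p (v : 'rV[R]_p) (i : 'I_p) : `|v 0 i| <= norm2 v.
Proof.
rewrite /norm2 -sqrtr_sqr ler_wsqrtr// (bigD1 i)//= lerDl sumr_ge0// => j _.
exact: sqr_ge0.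
Qed.

Lemma measurable_expR_sum_norm p (c : R) :
  measurable_fun [set: 'rV[R]_p]
    (fun v => expR (- c * \sum_(i < p) `|v 0 i|)).
Proof.
apply: measurableT_comp => //; apply: measurable_funM => //.
apply: measurable_sum => i; apply: measurableT_comp => //.
exact: (measurable_rV_coord i).
Qed.

Local Open Scope ereal_scope.

(** By evenness this is twice the half-line integral, where the integrand is [c^-1] times the
    exponential density of rate [c]. *)
Lemma integral_expR_norm_lty (c : R) : (0 < c)%R ->
  \int[mu]_x (expR (- c * `|x|))%:E < +oo.
Proof.
move=> c0.
rewrite ge0_symfun_integralT//; last 2 first.
- move=> x; apply: continuous_comp; last exact: continuous_expR.
  by apply: cvgM; [exact: cvg_cst|exact: norm_continuous].
- by move=> x /=; rewrite normrN.
apply: lte_mul_pinfty => //.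
have <- : \int[mu]_(x in [set x | (0 <= x)%R]) ((c^-1)%:E * (exponential_pdf c x)%:E) =
  \int[mu]_(x in [set x | (0 <= x)%R]) (expR (- c * `|x|))%:E.
  apply: eq_integral => x /set_mem /= x0.
  by rewrite exponential_pdfE// -EFinM mulrA mulVf ?gt_eqF// mul1r ger0_norm.
have mp : measurable_fun [set: R] (EFin \o exponential_pdf c).
  by apply/measurable_EFinP; exact: measurable_exponential_pdf.
have pge0 x : 0 <= (exponential_pdf c x)%:E.
  by rewrite lee_fin exponential_pdf_ge0// ltW.
have m0 : measurable [set x : R | (0 <= x)%R] by rewrite -set_itvcy.
rewrite ge0_integralZl//; [|exact: measurable_funTS|by rewrite lee_fin invr_ge0 ltW].
apply: lte_mul_pinfty => //; first by rewrite lee_fin invr_ge0 ltW.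
apply: (@le_lt_trans _ _ (\int[mu]_x (exponential_pdf c x)%:E)).
  apply: ge0_subset_integral => //; exact: measurableT.
by rewrite integral_exponential_pdf// ltry.
Qed.

(** The integrand is a product over coordinates; Tonelli splits off the first one. *)
Lemma integral_expR_sum_norm_lty p (c : R) : (0 < c)%R ->
  \int[lebesgue_rV p]_v (expR (- c * \sum_(i < p) `|v 0%R i|))%:E < +oo.
Proof.
move=> c0; elim: p => [|p IHp].
  rewrite /= integral_dirac//; last first.
    by apply/measurable_EFinP; exact: measurable_expR_sum_norm.
  by rewrite diracT mul1e ltry.
rewrite /= /lebesgue_rV_step.
rewrite (ge0_integral_pushforward (@measurable_rV_cons R p))//; last first.
  by apply/measurable_EFinP; exact: measurable_expR_sum_norm.
rewrite preimage_setT.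
set f := fun v => _ in IHp.
have fE xv : (expR (- c * \sum_(i < p.+1) `|rV_cons xv 0%R i|))%:E = (expR (- c * `|xv.1|))%:E * f xv.2.
  rewrite /f -EFinM -expRD -mulrDr big_ord_recl /rV_cons mxE unlift_none.
  by under eq_bigr do rewrite mxE liftK.
under eq_integral do rewrite /= fE.
have mg : measurable_fun [set: measurableTypeR R] (fun x => expR (- c * `|x|)).
  by apply: measurableT_comp => //; apply: measurable_funM.
have mf : measurable_fun [set: 'rV[R]_p] f.
  by apply/measurable_EFinP; exact: measurable_expR_sum_norm.
rewrite fubini_tonelli1/=; last 2 first.
- apply: emeasurable_funM; last exact: measurableT_comp mf measurable_snd.
  by apply/measurable_EFinP; exact: measurableT_comp mg measurable_fst.
- by move=> xv; rewrite mule_ge0// lee_fin expR_ge0.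
rewrite /fubini_F/=.
have If0 : 0 <= \int[lebesgue_rV p]_v f v.
  by apply: integral_ge0 => v _; rewrite lee_fin expR_ge0.
have cf (x : R) : \int[lebesgue_rV p]_v ((expR (- c * `|x|))%:E * f v) =
    (expR (- c * `|x|))%:E * \int[lebesgue_rV p]_v f v.
  by apply: ge0_integralZl => // v _; rewrite lee_fin expR_ge0.
under eq_integral do rewrite cf.
rewrite ge0_integralZr//; last exact/measurable_EFinP.
apply: lte_mul_pinfty => //.
  by apply: integral_ge0 => x _; rewrite lee_fin expR_ge0.
rewrite ge0_fin_numE ?integral_expR_norm_lty//.
by apply: integral_ge0 => x _; rewrite lee_fin expR_ge0.
Qed.

Lemma kernel_Z_gt0 p : (0 < kernel_Z (R := R) p)%R.
Proof.
have mk : measurable_fun [set: 'rV[R]_p] (fun v => (expR (- norm2 v))%:E).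
  apply/measurable_EFinP; apply: measurableT_comp => //.
  by apply: measurableT_comp => //; exact: measurable_norm2.
rewrite /kernel_Z /Rintegral fine_gt0//; apply/andP; split.
  (* Lower bound: the unit cube has measure 1, and on it the Euclidean norm is at most
     [Num.sqrt p%:R]. *)
  pose B := [set v : 'rV[R]_p | forall i, `[0%R, 1%R]%classic (v 0%R i)].
  have mB : measurable B.
    rewrite (_ : B = \bigcap_(i in [set` index_enum 'I_p])
        (rV_coord i @^-1` `[0%R, 1%R]%classic)).
      rewrite bigcap_seq; apply: bigsetI_measurable => i _.
      by rewrite -[X in measurable X]setTI; exact: measurable_rV_coord.
    apply/seteqP; split => v /= H i; first by move=> _; exact: H.
    by apply: H; rewrite /= mem_index_enum.
  apply: (@lt_le_trans _ _ (\int[lebesgue_rV p]_(v in B)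
      (expR (- Num.sqrt p%:R))%:E)).
    rewrite integral_cst//= mule_gt0 ?lte_fin ?expR_gt0//.
    have -> := lebesgue_rV_box (A := fun=> `[0%R, 1%R]%classic) (fun=> measurable_itv _).
    rewrite big1// => i _.
    by rewrite lebesgue_measure_itv/= lte01 oppr0 adde0.
  apply: (@le_trans _ _ (\int[lebesgue_rV p]_(v in B) (expR (- norm2 v))%:E)).
    apply: ge0_le_integral => //; first exact: measurable_funTS.
    move=> v Bv; rewrite lee_fin ler_expR lerN2 ler_wsqrtr//.
    rewrite -[X in (_ <= X%:R)%R]card_ord -sumr_const; apply: ler_sum => i _.
    by have := Bv i; rewrite /= in_itv/= => /andP[v0 v1]; rewrite expr_le1.
  apply: ge0_subset_integral => //; exact: measurableT.
(* Upper bound: the sum of the [|v_i|] is at most [p] times the Euclidean norm. Rate [p.+1%:R^-1]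
   rather than [p%:R^-1] keeps it positive at [p = 0]. *)
have p0 : (0 < p.+1%:R^-1 :> R)%R by rewrite invr_gt0.
apply: le_lt_trans (integral_expR_sum_norm_lty p _ p0).
apply: ge0_le_integral => //.
- by apply/measurable_EFinP; exact: measurable_expR_sum_norm.
move=> v _; rewrite lee_fin ler_expR mulNr lerN2 mulrC ler_pdivrMr//.
apply: (@le_trans _ _ (norm2 v * p%:R)%R).
  rewrite mulr_natr -[X in (_ *+ X)%R]card_ord -sumr_const; apply: ler_sum => i _.
  exact: normr_le_norm2.
by rewrite ler_wpM2l ?sqrtr_ge0// ler_nat.
Qed.

Local Close Scope ereal_scope.

Lemma expkernel_gt0 p (theta : 'rV[R]_p) : 0 < expkernel theta.
Proof. by rewrite mulr_gt0 ?expR_gt0// invr_gt0 kernel_Z_gt0. Qed.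

Section nw_weight.
Variables (n p : nat) (h : R) (gamma : 'rV[R]_p) (gam : 'I_n -> 'rV[R]_p).
Hypothesis n_gt0 : (0 < n)%N.

Let sum_expkernel_gt0 : 0 < \sum_(j < n) expkernel (h^-1 *: (gamma - gam j)).
Proof.
rewrite (bigD1 (Ordinal n_gt0))//= ltr_wpDr ?expkernel_gt0// sumr_ge0// => j _.
exact/ltW/expkernel_gt0.
Qed.

Lemma nw_weight_gt0 i : 0 < nw_weight h gamma gam i.
Proof. by rewrite divr_gt0// expkernel_gt0. Qed.

Lemma nw_weight_sum1 : \sum_(i < n) nw_weight h gamma gam i = 1.
Proof. by rewrite -mulr_suml divff// gt_eqF. Qed.

End nw_weight.
End kernel_normalization.

(** * Bounds on the worst-case expectation *)

Theorem proposition5 (R : realType) (n p q d : nat)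
  (X : set 'rV[R]_d) (Xi : set 'rV[R]_q)
  (l : 'rV[R]_d -> 'rV[R]_q -> R)
  (gam : 'I_n -> 'rV[R]_p) (xi : 'I_n -> 'rV[R]_q)
  (gamma : 'rV[R]_p) (h lambda : R)
  (n_gt0 : (0 < n)%N)
  (Xi_compact : compact Xi)
  (xi_Xi : forall i, Xi (xi i))
  (h_gt0 : 0 < h)
  (lambda_ge0 : 0 <= lambda)
  (l_01 : forall x z, X x -> Xi z -> 0 <= l x z <= 1)
  (l_convex : forall z, Xi z -> convex_function X (fun x => l x z)) :
  let wbar := nw_weight h gamma gam in
  forall x : 'rV[R]_d, X x ->
  let E := nw_mean wbar (fun i => l x (xi i)) in
  let V := nw_var wbar (fun i => l x (xi i)) in
  exists M : R,
    [/\ is_max [set ('E_P[l x])%E | P in chi2_ambiguity lambda wbar xi] M%:E,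
        E + Num.max (lambda * Num.sqrt V - lambda ^+ 2) 0 <= M,
        M <= E + lambda * Num.sqrt V
      & (lambda ^+ 2 <= V -> M = E + lambda * Num.sqrt V)].
Proof.
move=> wbar x Xx E V.
have w0 i : 0 < wbar i by exact: nw_weight_gt0.
have w1 : \sum_(i < n) wbar i = 1 by exact: nw_weight_sum1.
have sw : simplex wbar by split=> // i; exact: ltW.
have y01 i : 0 <= l x (xi i) <= 1 by exact: l_01.
pose y i := l x (xi i).
have V0 : 0 <= V by apply: nw_var_ge0 => i; exact: ltW.
have [w [ww wl wmax]] := chi2_ball_argmax wbar y lambda sw.
(* Each tilt inside the ball bounds the maximum from below; the second condition says that its
   distance [t ^+ 2 * V / 2] is at most [lambda ^+ 2 / 2]. *)
have tilt t : 0 <= t <= 1 -> t * Num.sqrt V <= lambda -> E + t * V <= nw_mean w y.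
  move=> t01 tl; rewrite -tilted_mean//; apply: wmax; first exact: tilted_simplex.
  rewrite tilted_chi2// -/V ler_pM2r ?invr_gt0// -(sqr_sqrtr V0) -exprMn.
  by rewrite ler_sqr ?nnegrE ?mulr_ge0 ?sqrtr_ge0//; case/andP: t01.
have ub : nw_mean w y <= E + lambda * Num.sqrt V.
  by apply: nw_mean_le => //; rewrite w1; case: ww.
have eqM : lambda ^+ 2 <= V -> nw_mean w y = E + lambda * Num.sqrt V.
  move=> lV; apply/eqP; rewrite eq_le ub/=.
  (* With zero variance the target is [E] itself, and [t = 0] replaces the quotient
     [lambda / Num.sqrt V]. *)
  have [sV0|sV0] := eqVneq (Num.sqrt V) 0.
    by have := tilt 0; rewrite sV0 !mul0r mulr0 lexx ler01; exact.
  have sV : 0 < Num.sqrt V by rewrite lt_def sV0 sqrtr_ge0.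
  have lsV : lambda <= Num.sqrt V.
    by rewrite -ler_sqr ?nnegrE ?sqrtr_ge0// sqr_sqrtr.
  rewrite (_ : lambda * Num.sqrt V = lambda / Num.sqrt V * V).
    apply: tilt; last by rewrite divfK.
    by rewrite divr_ge0 ?sqrtr_ge0//= ler_pdivrMr// mul1r.
  by rewrite -[X in _ / _ * X](sqr_sqrtr V0) expr2 mulrA divfK.
exists (nw_mean w y); split => //.
(* Expectations over the ambiguity set are exactly the means of feasible weights, so the maximizing
   [w] yields a maximizing measure. *)
- split=> [|_ [P [w' [Pw' w'l sw']] <-]].
    have [P Pw] := discrete_probability _ _ _ xi ww.
    by exists P; [exists w|rewrite (expectation_discrete _ ww Pw)].
  by rewrite (expectation_discrete _ sw' Pw') lee_fin; exact: wmax.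
- have [lV|Vl] := leP (lambda ^+ 2) V.
    rewrite eqM// lerD2l ge_max mulr_ge0 ?sqrtr_ge0// andbT.
    by rewrite gerBl sqr_ge0.
  have sl : Num.sqrt V <= lambda.
    by rewrite -ler_sqr ?nnegrE ?sqrtr_ge0// sqr_sqrtr// ltW.
  (* The gain at [t = 1] is [V]; with [s = Num.sqrt V] it remains that
     [s ^+ 2 - lambda * s + lambda ^+ 2 >= 0]. *)
  apply: le_trans (tilt 1 _ _); rewrite ?ler01 ?lexx ?mul1r//.
  rewrite lerD2l ge_max V0 andbT.
  by have := sqr_sqrtr V0; have := sqrtr_ge0 V; nra.
Qed.
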